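(* Let $\mathscr{I}$ be a non-empty set. For each $i\in\mathscr{I}$ let $\lambda_i\geqslant 1$ be a cardinal, let $S_i$ be a Hausdorff $\omega$-bounded semitopological monoid with zero, and let $B^0_{\lambda_i}(S_i)$ be a Hausdorff countably compact topological Brandt $\lambda_i^0$-extension of $S_i$. Then the direct product $\prod\{B^0_{\lambda_i}(S_i)\colon i\in\mathscr{I}\}$ with the Tychonoff topology is an $\omega$-bounded semitopological semigroup.
   Context: All topological spaces are Hausdorff. A semitopological semigroup is a Hausdorff topological space with a separately continuous associative operation; a semitopological monoid is a semitopological semigroup with identity. Direct products of semigroups carry the coordinatewise operation. Brandt $\lambda^0$-extension: for a monoid $S$ with zero $0_S$ and a cardinal $\lambda\geqslant 1$, $B^0_\lambda(S)$ is the set $\{(\alpha,s,\beta)\colon \alpha,\beta\in\lambda,\ s\in S\setminus\{0_S\}\}\sqcup\{0\}$ with the operation in which $0$ is the zero and $(\alpha,a,\beta)\cdot(\gamma,b,\delta)$ equals $(\alpha,ab,\delta)$ if $\beta=\gamma$ and $ab\neq 0_S$, and equals $0$ otherwise. For $\alpha,\beta\in\lambda$ put $S_{\alpha,\beta}=\{(\alpha,s,\beta)\colon s\in S\setminus\{0_S\}\}\cup\{0\}$. Topological Brandt $\lambda^0$-extension: for a semitopological monoid $(S,\tau)$ with zero, it is $B^0_\lambda(S)$ with a Hausdorff topology $\tau_B$ such that $(B^0_\lambda(S),\tau_B)$ is a semitopological semigroup and, for some $\alpha\in\lambda$, the map $0_S\mapsto 0$, $s\mapsto(\alpha,s,\alpha)$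 ($s\neq 0_S$) is a homeomorphism of $(S,\tau)$ onto the subspace $S_{\alpha,\alpha}$. A space is countably compact if each countable open cover has a finite subcover, and $\omega$-bounded if every countably infinite subset has compact closure. *)

(* Defs.v *)
From HB Require Import structures.
From mathcomp Require Import all_boot monoid.
From mathcomp Require Import all_classical topology function_spaces.

Set Implicit Arguments.
Unset Strict Implicit.
Unset Printing Implicit Defensive.

Local Open Scope classical_set_scope.
Local Open Scope group_scope.

(* Semigroups carrying a topology; the compatibility of the two is the separate
   predicate [semitopological]. *)
#[short(type="topSemigroupType")]
HB.structure Definition TopSemigroup := {S of Semigroup S & Topological S}.

HB.mixin Record Monoid_hasZero S of Monoid S := {
  zerog : S;
  mul0g : left_zero zerog (@mul S);
  mulg0 : right_zero zerog (@mul S)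
}.

#[short(type="monoid0Type")]
HB.structure Definition Monoid0 := {S of Monoid_hasZero S & Monoid S}.

#[short(type="topMonoid0Type")]
HB.structure Definition TopMonoid0 := {S of Monoid0 S & Topological S}.

(* Associativity is part of [topSemigroupType]; "semitopological" includes
   Hausdorff. *)
Definition semitopological (S : topSemigroupType) : Prop :=
  hausdorff_space S /\
  forall a : S, continuous (fun x : S => a * x) /\
                continuous (fun x : S => x * a).

Definition countably_compact (T : topologicalType) : Prop :=
  forall (I : choiceType) (D : set I) (f : I -> set T), countable D ->
  (forall i, D i -> open (f i)) -> [set: T] `<=` cover D f ->
  finite_subset_cover D f [set: T].

Definition omega_bounded (T : topologicalType) : Prop :=
  forall A : set T, countable A -> infinite_set A -> compact (closure A).

Definition homeomorphism_onto (T U : topologicalType) (f : T -> U)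
    (A : set U) : Prop :=
  [/\ set_bij [set: T] A f, continuous f &
      exists2 g : U -> T, cancel f g & {within A, continuous g}].

Section DirectProduct.
Context (I : Type) (K : I -> topSemigroupType).

Definition prod_mul (f g : prod_topology K) : prod_topology K :=
  fun i => f i * g i.

Lemma prod_mulA : associative prod_mul.
Proof.
by move=> f g h; apply: functional_extensionality_dep => i; exact: mulgA.
Qed.

HB.instance Definition _ := isSemigroup.Build (prod_topology K) prod_mulA.

End DirectProduct.

(* The Brandt lambda^0-extension, with the index set L in the role of the
   cardinal lambda: [None] is the zero and [Some (a, s, b)] is the triple
   (a, s, b) with s nonzero. *)
Definition brandt (L : choiceType) (S : monoid0Type) : Type :=
  option (L * {s : S | s != zerog} * L).

HB.instance Definition _ (L : choiceType) (S : monoid0Type) :=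
  Choice.on (brandt L S).

Section Brandt.
Context (L : choiceType) (S : monoid0Type).

Definition brandt_zero : brandt L S := None.

(* The triple (a, s, b) when s is nonzero, and the zero otherwise. *)
Definition brandt_elt (a : L) (s : S) (b : L) : brandt L S :=
  if insub s is Some u then Some (a, u, b) else brandt_zero.

Definition brandt_mul (x y : brandt L S) : brandt L S :=
  match x, y with
  | Some (a, s, b), Some (c, t, d) =>
      if b == c then brandt_elt a (val s * val t) d else brandt_zero
  | _, _ => brandt_zero
  end.

Lemma brandt_mulA : associative brandt_mul.
Proof.
have elt0 a b : brandt_elt a zerog b = brandt_zero.
  by rewrite /brandt_elt insubN// eqxx.
have eltl a s b c t d : brandt_mul (brandt_elt a s b) (Some (c, t, d)) =
    if b == c then brandt_elt a (s * val t) d else brandt_zero.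
  rewrite {1}/brandt_elt; case: insubP => [u _ <-//|/negPn/eqP ->].
  by rewrite mul0g elt0 if_same.
have eltr a s b c t d : brandt_mul (Some (a, s, b)) (brandt_elt c t d) =
    if b == c then brandt_elt a (val s * t) d else brandt_zero.
  rewrite {1}/brandt_elt; case: insubP => [u _ <-//|/negPn/eqP ->].
  by rewrite mulg0 elt0 if_same.
have mulx0 x : brandt_mul x brandt_zero = brandt_zero.
  by case: x => [[[? ?] ?]|].
case=> [[[a s] b]|//] [[[c t] d]|//] [[[e u] f]|]; last by rewrite !mulx0.
have -> : brandt_mul (Some (c, t, d)) (Some (e, u, f)) =
  if d == e then brandt_elt c (val t * val u) f else brandt_zero by [].
have -> : brandt_mul (Some (a, s, b)) (Some (c, t, d)) =
  if b == c then brandt_elt a (val s * val t) d else brandt_zero by [].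
by case: (d == e) (eltl a (val s * val t) d e u f) => h; case: (b == c)
  (eltr a s b c (val t * val u) f) => h'; rewrite ?h ?h' ?mulgA.
Qed.

HB.instance Definition _ := isSemigroup.Build (brandt L S) brandt_mulA.

(* The subset S_{a,b}. *)
Definition brandt_block (a b : L) : set (brandt L S) :=
  [set x | x = brandt_zero \/ exists s, x = Some (a, s, b)].

End Brandt.

Record topology (T : Type) := Topology {
  topo_open : set_system T;
  topo_openT : topo_open setT;
  topo_openI : setI_closed topo_open;
  topo_open_bigU : forall (I : Type) (f : I -> set T),
    (forall i, topo_open (f i)) -> topo_open (\bigcup_i f i)
}.

(* The semigroup [brandt L S] with the topology [tau]. *)
Definition brandt_space (L : choiceType) (S : monoid0Type)
  (tau : topology (brandt L S)) : Type := brandt L S.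

Section BrandtSpace.
Context (L : choiceType) (S : monoid0Type) (tau : topology (brandt L S)).

HB.instance Definition _ :=
  Semigroup.copy (brandt_space tau) (brandt L S).

HB.instance Definition _ := isOpenTopological.Build (brandt_space tau)
  (topo_openT tau) (@topo_openI _ tau) (@topo_open_bigU _ tau).

End BrandtSpace.

Definition topological_brandt (L : choiceType) (S : topMonoid0Type)
    (tau : topology (brandt L S)) : Prop :=
  semitopological (brandt_space tau) /\
  exists a : L, homeomorphism_onto
    (fun s : S => brandt_elt a s a : brandt_space tau)
    (brandt_block a a : set (brandt_space tau)).

(* Main.v *)
Require Import Defs.
From mathcomp Require Import all_boot monoid.
From mathcomp Require Import all_classical topology function_spaces.

Local Open Scope classical_set_scope.

(** Write B for one Brandt extension and e_a = (a, 1, a). In a Hausdorff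
    semitopological B the map x |-> e_a x e_b is continuous, and it sends x to a
    nonzero element exactly when x lies in S_{a,b} minus 0; hence each set
    S_{a,b} minus 0 is open ([open_brandt_block]). These sets are pairwise
    disjoint and cover everything but 0, so countable compactness forces every
    neighbourhood of 0 to contain all but finitely many S_{a,b}
    ([finite_brandt_block_outside]).

    Multiplying the given embedding s |-> (c, s, c) by (a, 1, c) on the left and
    by (c, 1, b) on the right shows that every s |-> (a, s, b) is a continuous
    injection of S onto S_{a,b}. So the part of a countable subset A of B lying
    in S_{a,b} comes from a countable subset of S, whose closure is compact; its
    image is a compact set C_{a,b} inside S_{a,b}. The union of {0} and of all
    C_{a,b} is compact because the C_{a,b} shrink to 0
    ([compact_bigcup_cofinite]); it contains A, hence the closure of A, and B is
    omega-bounded ([omega_bounded_brandt]).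

    For the product, the closure of a countable set lies in the product of the
    closures of its projections, which is compact by Tychonoff's theorem
    ([omega_bounded_prod]). *)

(** * Generalities on compactness and products *)

Lemma infinite_countable_subset (T : Type) (A : set T) :
  infinite_set A -> exists B, [/\ B `<=` A, countable B & infinite_set B].
Proof.
elim/Ppointed: T => T in A *; first by rewrite emptyE => /(_ (finite_set0 _)).
move=> /infiniteP/ppcard_leP[f]; exists (range f); split.
- by move=> _ [n _ <-]; exact: funS.
- exact: card_image_le.
- by apply/infiniteP; rewrite (card_le_eqr (card_image f)) card_lexx.
Qed.

(** A countably infinite set may project, or pull back along an injection, to a
    finite set; hence the need to cover finite sets as well. *)
Lemma omega_bounded_compact_closure (T : topologicalType) (A : set T) :
  hausdorff_space T -> omega_bounded T -> countable A -> compact (closure A).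
Proof.
move=> hT wT cA; have [fA|iA] := pselect (finite_set A); last exact: wT.
have /compact_closed-/(_ hT)/closure_id <- := finite_compact fA.
exact: finite_compact.
Qed.

Lemma continuous_prod (I : Type) (K : I -> topologicalType)
    (T : topologicalType) (f : T -> prod_topology K) :
  (forall i, continuous (fun x => f x i)) -> continuous f.
Proof.
move=> cf x; apply/cvg_sup => i.
exact: (@continuous_comp_initial _ _ _ (fun g : forall i, K i => g i) f (cf i)).
Qed.

Lemma proj_prod_continuous (I : Type) (K : I -> topologicalType) (i : I) :
  continuous (fun f : prod_topology K => f i).
Proof. exact: (@proj_continuous {classic I} K i). Qed.

Lemma semitopological_prod (I : Type) (K : I -> topSemigroupType) :
  (forall i, semitopological (K i)) -> semitopological (prod_topology K).
Proof.
move=> sK; split.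
  by apply: (@hausdorff_product {classic I} K) => i; have [] := sK i.
move=> a; split; apply: continuous_prod => i x.
  apply: (@continuous_comp _ _ _ (fun f : prod_topology K => f i)
    (fun y => a i * y)%g); first exact: proj_prod_continuous.
  by have [_ /(_ (a i))[+ _]] := sK i; exact.
apply: (@continuous_comp _ _ _ (fun f : prod_topology K => f i)
  (fun y => y * a i)%g); first exact: proj_prod_continuous.
by have [_ /(_ (a i))[_ +]] := sK i; exact.
Qed.

(** The closure of [A] lies in the product of the closures of its projections,
    each of which is the closure of a countable set. *)
Lemma omega_bounded_prod (I : Type) (K : I -> topologicalType) :
  (forall i, hausdorff_space (K i)) -> (forall i, omega_bounded (K i)) ->
  omega_bounded (prod_topology K).
Proof.
move=> hK wK A cA _.
pose C i := closure ((fun f : prod_topology K => f i) @` A).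
have cC i : compact (C i).
  apply: omega_bounded_compact_closure => //.
  by apply: sub_countable cA; exact: card_image_le.
have := @tychonoff {classic I} K C cC => cP.
apply: (subclosed_compact (@closed_closure _ A) cP) => f Af i.
move=> U Uf; have [g [Ag Ug]] := Af _ (@proj_prod_continuous I K i f U Uf).
by exists (g i); split => //; exists g.
Qed.

(** A family of compact sets that shrinks to [z] behaves like a convergent
    sequence with its limit: a filter on the union that does not cluster at [z]
    contains the complement of a neighbourhood of [z], hence a finite union of
    members of the family. *)
Lemma compact_bigcup_cofinite (T : topologicalType) (J : choiceType) (z : T)
    (C : J -> set T) :
  (forall j, compact (C j)) ->
  (forall U, open U -> U z -> finite_set [set j | ~ C j `<=` U]) ->
  compact (z |` \bigcup_j C j).
Proof.
move=> cC finC F FF FC.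
have [zF|nzF] := pselect (cluster F z); first by exists z; split => //; left.
have /existsNP[G /existsNP[U]] : ~ (F `#` open_nbhs z).
  by move: nzF; rewrite clusterEonbhs.
move=> /not_implyP[FG] /not_implyP[[oU Uz]] /set0P/negP/negPn/eqP GU0.
have finU := finC U oU Uz.
have cK : compact (\bigcup_(j in [set j | ~ C j `<=` U]) C j).
  by rewrite -bigsetU_fset_set //; exact: bigsetU_compact.
have FK : F (\bigcup_(j in [set j | ~ C j `<=` U]) C j).
  apply: filterS (filterI FC FG) => x [[->|[j _ Cjx]] Gx].
    by have : (G `&` U) z by []; rewrite GU0.
  exists j => //= CU; have : (G `&` U) x by split => //; exact: CU.
  by rewrite GU0.
have [x [[j _ Cjx] Fx]] := cK F FF FK.
by exists x; split => //; right; exists j.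
Qed.

(** * Multiplication in the Brandt extension *)

Section BrandtAlgebra.
Context (L : choiceType) (S : monoid0Type).
Implicit Types (a b c d : L) (s t : S).
Local Open Scope group_scope.

Lemma brandt_elt0 a b : brandt_elt a (zerog : S) b = brandt_zero L S.
Proof. by rewrite /brandt_elt insubN// eqxx. Qed.

Lemma brandt_elt_val a (u : {s : S | s != zerog}) b :
  brandt_elt a (val u) b = Some (a, u, b).
Proof. by rewrite /brandt_elt valK. Qed.

Lemma brandt_eltM a s b c t d :
  brandt_elt a s b * brandt_elt c t d =
  if b == c then brandt_elt a (s * t) d else brandt_zero L S.
Proof.
rewrite {1 2}/brandt_elt; case: insubP => [u _ <-|/negPn/eqP->]; last first.
  by rewrite mul0g brandt_elt0 if_same.
by case: insubP => [v _ <-//|/negPn/eqP->]; rewrite mulg0 brandt_elt0 if_same.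
Qed.

Lemma brandt_elt_inj a b : injective (fun s => brandt_elt a s b).
Proof.
rewrite /brandt_elt => s t; case: insubP => [u _ <-|/negPn/eqP->].
  by case: insubP => [v _ <- [->]|].
by case: insubP => [|/negPn/eqP->].
Qed.

(** This turns membership in a block into a condition on the value of a
    two-sided multiplication, which is a continuous map. *)
Lemma brandt_sandwich a b (x : brandt L S) :
  brandt_elt a 1 a * x * brandt_elt b 1 b <> brandt_zero L S <->
  (brandt_block a b `\ brandt_zero L S) x.
Proof.
case: x => [[[c u] d]|]; last first.
  rewrite -[None](brandt_elt0 a b) !(brandt_eltM, eqxx) mulg0 mul0g brandt_elt0.
  by split=> // -[_ /(_ erefl)].
have -> : (brandt_block a b `\ brandt_zero L S) (Some (c, u, d)) <->
    (a == c) && (d == b).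
  split=> [[[//|[v [-> _ ->]]] _]|/andP[/eqP-> /eqP<-]]; first by rewrite !eqxx.
  by split=> //; right; exists u.
rewrite -brandt_elt_val brandt_eltM; case: (a == c) => /=; last by split.
rewrite brandt_eltM; case: (d == b) => /=; last by split.
by rewrite mul1g mulg1 brandt_elt_val.
Qed.

End BrandtAlgebra.

(** * Topology of the Brandt extension *)

Section BrandtTopology.
Context (L : choiceType) (S : topMonoid0Type) (tau : topology (brandt L S)).
Local Notation B := (brandt_space tau).
Implicit Types (a b : L) (s : S).
Context (semiB : semitopological B).
Local Open Scope group_scope.

Lemma two_sided_mul_continuous (u v : B) : continuous (fun x : B => u * x * v).
Proof.
have [_ cB] := semiB; move=> x.
apply: (@continuous_comp _ _ _ (fun y : B => u * y) (fun y : B => y * v)).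
  by have [+ _] := cB u; exact.
by have [_ +] := cB v; exact.
Qed.

Lemma open_brandt_block a b :
  open (brandt_block a b `\ brandt_zero L S : set B).
Proof.
set V := (_ `\ _).
have -> : V = (fun x : B => (brandt_elt a 1 a : B) * x * (brandt_elt b 1 b : B))
    @^-1` (~` [set (brandt_zero L S : B)]).
  by apply/seteqP; split=> x /brandt_sandwich.
apply: open_comp => [x _|]; first exact: two_sided_mul_continuous.
apply/closed_openC/accessible_closed_set1/hausdorff_accessible.
by have [] := semiB.
Qed.

(** Were infinitely many blocks to stick out of [U], pick countably infinitely
    many of them, indexed by [Q]. Removing one of these blocks from the cover of
    [B] by [U] and all the open sets S_{a,b} minus 0 uncovers its points outside
    [U], since the blocks meet only at 0. Merging the members that do not come
    from [Q] leaves a countable cover without a finite subcover. *)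
Lemma finite_brandt_block_outside (U : set B) :
  countably_compact B -> open U -> U (brandt_zero L S) ->
  finite_set
    [set p : L * L | ~ brandt_block p.1 p.2 `<=` (U : set (brandt L S))].
Proof.
move=> ccB oU U0; set P := [set p | _]; apply: contrapT.
move=> /infinite_countable_subset[Q [QP cQ iQ]].
pose V (p : L * L) : set B := brandt_block p.1 p.2 `\ brandt_zero L S.
have oV p : open (V p) by exact: open_brandt_block.
pose W : set B := U `|` \bigcup_(p in ~` Q) V p.
(* [W] is joined to every member, so that the countable set [Q] can itself serve
   as the index set. *)
have [||D _ cov] := ccB _ Q (fun p => W `|` V p) cQ.
- move=> p _; apply: openU; last exact: oV.
  by apply: openU => //; exact: bigcup_open.
- have [q Qq] := infinite_setN0 iQ.
  move=> [[[a u] b]|] _; last by exists q => //; left; left.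
  have Vx : V (a, b) (Some (a, u, b)) by split=> //; right; exists u.
  have [Qab|nQab] := pselect (Q (a, b)); first by exists (a, b) => //; right.
  by exists q => //; left; right; exists (a, b).
apply: iQ; apply: sub_finite_set (finite_fset D) => p Qp /=.
have /existsNP[x /not_implyP[px nUx]] := QP p Qp.
have x0 : x <> brandt_zero L S by move=> x0; apply: nUx; rewrite x0.
have Vpx q : V q x -> q = p.
  case: px => [/x0//|[u ->]] [[//|[v [+ _ +]]] _] {nUx Qp}.
  by case: p q => [? ?] [? ?] /= -> ->.
have [q Dq [[|[r nQr /Vpx rp]]|/Vpx <-]] //= := cov x I.
by rewrite rp in nQr.
Qed.

(** The embedding at one diagonal block [(c, c)] is carried to the block
    [(a, b)] by the translations (a, 1, c) and (c, 1, b). *)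
Lemma brandt_elt_continuous c a b :
  continuous (fun s => brandt_elt c s c : B) ->
  continuous (fun s => brandt_elt a s b : B).
Proof.
move=> ch; have -> : (fun s => brandt_elt a s b : B) =
    (fun x : B => (brandt_elt a 1 c : B) * x * (brandt_elt c 1 b : B)) \o
    (fun s => brandt_elt c s c : B).
  apply/funext => s /=; rewrite [X in X * _]brandt_eltM eqxx.
  by rewrite [RHS]brandt_eltM eqxx mul1g mulg1.
move=> s; apply: continuous_comp; first exact: ch.
exact: two_sided_mul_continuous.
Qed.

End BrandtTopology.

(** The closure of a countable set is trapped in the union of 0 and of one
    compact subset of each block, and these compact sets shrink to 0. *)
Lemma omega_bounded_brandt (L : choiceType) (S : topMonoid0Type)
    (tau : topology (brandt L S)) :
  hausdorff_space S -> omega_bounded S -> topological_brandt tau ->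
  countably_compact (brandt_space tau) -> omega_bounded (brandt_space tau).
Proof.
move=> hS wS [semiB [c [_ ch _]]] ccB A cA _.
pose e (p : L * L) (s : S) : brandt_space tau := brandt_elt p.1 s p.2.
have ce p : continuous (e p) by apply: brandt_elt_continuous ch.
pose C p := e p @` closure (e p @^-1` A).
have cC p : compact (C p).
  apply: continuous_compact; first exact: continuous_subspaceT.
  apply: omega_bounded_compact_closure => //; apply: sub_countable cA.
  by apply: card_ge_preimage => s t _ _; exact: brandt_elt_inj.
have Cblock p : C p `<=` brandt_block p.1 p.2.
  move=> _ [s _ <-]; rewrite /e /brandt_elt; case: insubP => [u _ _|_].
    by right; exists u.
  by left.
have cK : compact ((brandt_zero L S : brandt_space tau) |` \bigcup_p C p).
  apply: compact_bigcup_cofinite => // U oU U0.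
  apply: sub_finite_set (finite_brandt_block_outside _ _ _ semiB U ccB oU U0).
  by move=> p nCU bU; apply: nCU; apply: subset_trans bU; exact: Cblock.
have [hB _] := semiB.
apply: (subclosed_compact (@closed_closure _ A) cK).
have /closure_id -> := compact_closed hB cK.
apply: closureS => -[[[a u] b]|] Ax; last by left.
right; exists (a, b) => //; exists (val u); last exact: brandt_elt_val.
by apply: subset_closure; rewrite /= /e brandt_elt_val.
Qed.

Theorem theorem2p9 (I : Type) (lambda : I -> choiceType)
    (S : I -> topMonoid0Type)
    (tau : forall i, topology (brandt (lambda i) (S i))) :
  [set: I] !=set0 ->
  (forall i, [set: lambda i] !=set0) ->
  (forall i, semitopological (S i)) ->
  (forall i, omega_bounded (S i)) ->
  (forall i, topological_brandt (tau i)) ->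
  (forall i, countably_compact (brandt_space (tau i))) ->
  semitopological (prod_topology (fun i => brandt_space (tau i))) /\
  omega_bounded (prod_topology (fun i => brandt_space (tau i))).
Proof.
move=> _ _ semiS wS brB ccB.
have semiB i : semitopological (brandt_space (tau i)) by have [] := brB i.
split; first exact: semitopological_prod.
apply: omega_bounded_prod => i; first by have [] := semiB i.
by apply: omega_bounded_brandt => //; have [] := semiS i.
Qed.
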